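(* Let $\mathcal{F}=((X,d),(f_i)_{i\in I})$ be a generalized possibly infinite iterated function system of order $m\in\mathbb{N}^*$ such that $I$ is finite and all the functions $f_i$, $i\in I$, are Meir-Keeler. Then the operator $H_{\mathcal{F}}:\mathcal{C}^m\to\mathcal{C}$ is Meir-Keeler.
   Context: $\mathbb{N}^{*}=\{1,2,\dots\}$. The sets $X$ and $I$ are nonempty. For a metric space $(Y,\rho)$ and $m\in\mathbb{N}^*$, $Y^m$ carries the maximum metric $\rho_{\max}((x_1,\dots,x_m),(y_1,\dots,y_m))=\max_j \rho(x_j,y_j)$. A map $f:Y^m\to Y$ on a metric space $(Y,\rho)$ is Meir-Keeler if for every $\varepsilon>0$ there is $\delta_\varepsilon>0$ such that $\rho(f(x),f(y))<\varepsilon$ for all $x,y\in Y^m$ with $\rho_{\max}(x,y)<\varepsilon+\delta_\varepsilon$. A generalized possibly infinite iterated function system of order $m$ is a pair $\mathcal{F}=((X,d),(f_i)_{i\in I})$, where $(X,d)$ is a metric space, each $f_i:X^m\to X$ is continuous, and the family $(f_i)_{i\in I}$ is bounded, i.e. $\bigcup_{i\in I}f_i(B)$ is bounded for every bounded $B\subseteq X^m$. Code space: $\Omega_1=I$, $\Omega_{k+1}=\Omega_k\times\dots\times\Omega_k$ ($m$ times), and $\Omega=\Omega_1\times\Omega_2\times\cdots$. Elements of $\Omega$ are written $\alpha=\alpha^1\alpha^2\dots\alpha^k\dots$ with $\alpha^k\in\Omega_k$; for $k\ge2$ write $\alpha^k=\alpha^k_1\alpha^k_2\dots\alpha^k_m$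 with $\alpha^k_i\in\Omega_{k-1}$, and for $i\in\{1,\dots,m\}$ put $\alpha(i)=\alpha^2_i\alpha^3_i\alpha^4_i\dots\in\Omega$. $\Omega$ is endowed with the metric $d(\alpha,\beta)=\sum_{k\ge1}c^k\,\delta(\alpha^k,\beta^k)$, where $c\in(0,1)$ is fixed and $\delta(\alpha^k,\beta^k)$ is $1$ if $\alpha^k\neq\beta^k$ and $0$ otherwise. $\mathcal{C}$ is the set of continuous bounded functions $f:\Omega\to X$ with the metric $d_u(f,g)=\sup_{\alpha\in\Omega}d(f(\alpha),g(\alpha))$; $\mathcal{C}^m$ carries the corresponding maximum metric. The operator $H_{\mathcal{F}}:\mathcal{C}^m\to\mathcal{C}$ is $H_{\mathcal{F}}(g_1,\dots,g_m)(\alpha)=f_{\alpha^1}(g_1(\alpha(1)),\dots,g_m(\alpha(m)))$ for $\alpha=\alpha^1\alpha^2\dots\in\Omega$. *)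

(* Defs.v *)
From HB Require Import structures.
From mathcomp Require Import all_boot all_order all_algebra.
From mathcomp Require Import all_classical all_reals all_analysis.

Set Implicit Arguments.
Unset Strict Implicit.
Unset Printing Implicit Defensive.

Import Order.TTheory GRing.Theory Num.Theory.
Import numFieldNormedType.Exports.
Import metricType_numDomainType.

Local Open Scope classical_set_scope.
Local Open Scope ring_scope.

Section MaxMetric.
Context {R : realType} (J : finType) (Y : metricType R).
Implicit Types x y z : {ffun J -> Y}.

(* All distances are nonnegative, so the neutral element 0 does not affect
   the maximum when J is nonempty. *)
Definition max_dist x y : R := \big[Num.max/0]_(j : J) mdist (x j) (y j).

Lemma max_dist_ge x y j : mdist (x j) (y j) <= max_dist x y.
Proof. exact: (le_bigmax _ (fun j => mdist (x j) (y j))). Qed.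

Lemma max_dist_le x y (M : R) :
  0 <= M -> (forall j, mdist (x j) (y j) <= M) -> max_dist x y <= M.
Proof. by move=> M0 xyM; apply: bigmax_le. Qed.

Lemma max_dist_ge0 x y : 0 <= max_dist x y.
Proof. exact: bigmax_ge_id. Qed.

Lemma max_distxx x : max_dist x x = 0.
Proof.
apply/eqP; rewrite eq_le max_dist_ge0 andbT.
by apply: max_dist_le => // j; rewrite mdistxx.
Qed.

Lemma max_dist_eq0 x y : max_dist x y = 0 -> x = y.
Proof.
move=> xy0; apply/ffunP => j; apply: mdist_positivity.
by apply/eqP; rewrite eq_le mdist_ge0 andbT -xy0 max_dist_ge.
Qed.

Lemma max_dist_sym x y : max_dist x y = max_dist y x.
Proof. by apply: eq_bigr => j _; rewrite metric_sym. Qed.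

Lemma max_dist_triangle y x z : max_dist x z <= max_dist x y + max_dist y z.
Proof.
apply: max_dist_le => [|j]; first by rewrite addr_ge0 ?max_dist_ge0.
by rewrite (le_trans (metric_triangle _ (y j) _))// lerD ?max_dist_ge.
Qed.

HB.instance Definition _ := @isMetric.Build R {ffun J -> Y}
  max_dist max_distxx max_dist_eq0 max_dist_sym max_dist_triangle.

End MaxMetric.

Definition meir_keeler {R : realType} {Y : metricType R} {m : nat}
    (f : {ffun 'I_m -> Y} -> Y) : Prop :=
  forall eps : R, 0 < eps -> exists2 delta : R, 0 < delta &
    forall x y : {ffun 'I_m -> Y},
      mdist x y < eps + delta -> mdist (f x) (f y) < eps.

Definition metric_bounded {R : realType} {Y : metricType R} (B : set Y) : Prop :=
  exists M : R, forall x y, B x -> B y -> mdist x y <= M.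

Record gifs {R : realType} (X : metricType R) (I : Type) (m : nat) := Gifs {
  gifs_fun :> I -> {ffun 'I_m -> X} -> X ;
  gifs_continuous : forall i, continuous (gifs_fun i) ;
  gifs_bounded : forall B : set {ffun 'I_m -> X}, metric_bounded B ->
    metric_bounded (\bigcup_(i in [set: I]) (gifs_fun i @` B)) }.

Arguments gifs_continuous {R X I m} _ i x.
Arguments gifs_bounded {R X I m} _ [B].

(* Indices start at 0: [code_level m I k] is $\Omega_{k+1}$. *)
Fixpoint code_level (m : nat) (I : choiceType) (k : nat) : choiceType :=
  if k is k'.+1 then {ffun 'I_m -> code_level m I k'} else I.

(* The parameter [hc] plays no role in the carrier; it selects the metric. *)
Definition code_space {R : realType} {c : R} (hc : 0 < c < 1)
  (m : nat) (I : choiceType) : Type := forall k, code_level m I k.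

Section CodeMetric.
Context {R : realType} {c : R} (hc : 0 < c < 1) (m : nat) (I : choiceType).
Local Notation Omega := (code_space hc m I).
Implicit Types a b : Omega.

HB.instance Definition _ := gen_eqMixin Omega.
HB.instance Definition _ := gen_choiceMixin Omega.

Definition code_term a b (k : nat) : R := c ^+ k.+1 * (a k != b k)%:R.

Definition code_dist a b : R := limn (series (code_term a b)).

Let c_gt0 : 0 < c. Proof. by case/andP: hc. Qed.
Let c_lt1 : c < 1. Proof. by case/andP: hc. Qed.

Lemma code_term_ge0 a b k : 0 <= code_term a b k.
Proof. by rewrite mulr_ge0// exprn_ge0// ltW. Qed.

Lemma is_cvg_code_term a b : cvgn (series (code_term a b)).
Proof.
apply: (@series_le_cvg _ _ (geometric c c)).
- exact: code_term_ge0.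
- by move=> k; rewrite /= mulr_ge0 ?exprn_ge0// ltW.
- move=> k; rewrite /code_term/= -exprS ler_piMr//; last by case: eqP.
  by rewrite exprn_ge0// ltW.
- by apply: is_cvg_geometric_series; rewrite ger0_norm// ltW.
Qed.

Arguments is_cvg_code_term : clear implicits.

Lemma code_dist_ge_series a b n : series (code_term a b) n <= code_dist a b.
Proof.
apply: nondecreasing_cvgn_le; last exact: is_cvg_code_term.
by apply: nondecreasing_series => k _ _; apply: code_term_ge0.
Qed.

Lemma code_dist_ge_term a b n : code_term a b n <= code_dist a b.
Proof.
apply: le_trans (code_dist_ge_series a b n.+1).
rewrite seriesEnat/= big_nat_recr//= lerDr sumr_ge0// => k _.
exact: code_term_ge0.
Qed.

Lemma code_distxx a : code_dist a a = 0.
Proof.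
rewrite /code_dist (_ : series _ = fun=> 0) ?lim_cst//.
apply/funext => n; rewrite seriesEnat/= big1// => k _.
by rewrite /code_term eqxx mulr0.
Qed.

Lemma code_dist_lt a b k : code_dist a b < c ^+ k.+1 -> a k = b k.
Proof.
move=> abk; apply/eqP; apply: contraTT abk => akb.
rewrite -leNgt; apply: le_trans (code_dist_ge_term a b k).
by rewrite /code_term akb mulr1.
Qed.

Lemma code_dist_eq0 a b : code_dist a b = 0 -> a = b.
Proof.
move=> ab0; apply: functional_extensionality_dep => k.
by apply: code_dist_lt; rewrite ab0 exprn_gt0.
Qed.

Lemma code_dist_sym a b : code_dist a b = code_dist b a.
Proof.
rewrite /code_dist (_ : code_term a b = code_term b a)//.
by apply/funext => k; rewrite /code_term eq_sym.
Qed.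

Lemma code_dist_triangle b a d :
  code_dist a d <= code_dist a b + code_dist b d.
Proof.
have [cab cbd] := (is_cvg_code_term a b, is_cvg_code_term b d).
rewrite /code_dist -limD//.
apply: ler_lim; [exact: is_cvg_code_term|exact: is_cvgD|].
apply: nearW => n; rewrite -[leRHS]/(series (code_term a b) n + series (code_term b d) n).
rewrite !seriesEnat/= -big_split/= ler_sum// => k _.
rewrite /code_term -mulrDr ler_wpM2l ?exprn_ge0 ?(ltW c_gt0)//.
have [->|_] := eqVneq (a k) (b k); first by rewrite add0r.
by rewrite -natrD ler_nat (leq_trans (leq_b1 _))// leq_addr.
Qed.

HB.instance Definition _ := @isMetric.Build R Omega
  code_dist code_distxx code_dist_eq0 code_dist_sym code_dist_triangle.

(* $\alpha(j)$ drops $\alpha^1$ and keeps the $j$-th component of every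
   $\alpha^k$ with $k \ge 2$. *)
Definition code_proj (a : Omega) (j : 'I_m) : Omega :=
  fun k => (a k.+1 : {ffun 'I_m -> code_level m I k}) j.

Lemma near_code_head (a : Omega) : \forall b \near a, (b : Omega) 0%N = a 0%N.
Proof.
have := @cvgr_dist_lt _ Omega _ _ (nbhs_filter a) id a cvg_id c c_gt0.
by apply: filterS => b ab; apply/esym/code_dist_lt; rewrite expr1.
Qed.

Lemma code_proj_continuous (j : 'I_m) : continuous (code_proj^~ j).
Proof.
move=> a; apply/(@cvgrPdist_le _ Omega _ _ (nbhs_filter a)) => e e0.
have := @cvgr_dist_lt _ Omega _ _ (nbhs_filter a) id a cvg_id _ (mulr_gt0 e0 c_gt0).
apply: filterS => b abe.
suff ab : code_dist (code_proj a j) (code_proj b j) * c <= code_dist a b.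
  by rewrite -(ler_pM2r c_gt0) (le_trans ab)// ltW.
rewrite -ler_pdivlMr//; apply: limr_le; first exact: is_cvg_code_term.
apply: nearW => n; rewrite ler_pdivlMr// mulrC.
apply: le_trans (code_dist_ge_series a b n.+1).
rewrite !seriesEnat/= big_nat_recl//= mulr_sumr.
rewrite ler_wpDl ?code_term_ge0// ler_sum// => k _.
rewrite /code_term mulrA -exprS ler_wpM2l ?exprn_ge0 ?(ltW c_gt0)//.
rewrite ler_nat /code_proj; have [->|_] := eqVneq (a k.+1) (b k.+1).
  by rewrite eqxx.
by case: eqP.
Qed.

End CodeMetric.

Record bounded_continuous {R : realType} (T U : metricType R) :=
  BoundedContinuous {
    bcont_fun :> T -> U ;
    bcont_continuous : continuous bcont_fun ;
    bcont_bounded : metric_bounded (range bcont_fun) }.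

Arguments bcont_continuous {R T U} _ x.
Arguments bcont_bounded {R T U} _.

Section UniformMetric.
Context {R : realType} (T U : metricType R).
Local Notation C := (bounded_continuous T U).
Implicit Types f g h : C.

HB.instance Definition _ := gen_eqMixin C.
HB.instance Definition _ := gen_choiceMixin C.

Definition unif_dist f g : R := sup (range (fun t => mdist (f t) (g t))).

Lemma unif_dist_ge f g t : mdist (f t) (g t) <= unif_dist f g.
Proof.
have [[M fM] [N gN]] := (bcont_bounded f, bcont_bounded g).
apply: ub_le_sup; last by exists t.
exists (M + (mdist (f t) (g t) + N)) => _ [s _ <-].
rewrite (le_trans (metric_triangle _ (f t) _))// lerD ?fM//.
by rewrite (le_trans (metric_triangle _ (g t) _))// lerD ?gN.
Qed.

Lemma unif_dist_le f g (M : R) :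
  0 <= M -> (forall t, mdist (f t) (g t) <= M) -> unif_dist f g <= M.
Proof.
move=> M0 fgM; rewrite /unif_dist; set A := [set _ | _ in _].
have [->|/set0P A0] := eqVneq A set0; first by rewrite sup0.
by apply: ge_sup => // _ [t _ <-].
Qed.

Lemma unif_dist_ge0 f g : 0 <= unif_dist f g.
Proof.
rewrite /unif_dist; set A := [set _ | _ in _].
have [->|/set0P[_ [t _ _]]] := eqVneq A set0; first by rewrite sup0.
exact: le_trans (mdist_ge0 (f t) (g t)) (unif_dist_ge f g t).
Qed.

Lemma unif_distxx f : unif_dist f f = 0.
Proof.
apply/eqP; rewrite eq_le unif_dist_ge0 andbT.
by apply: unif_dist_le => // t; rewrite mdistxx.
Qed.

Lemma unif_dist_eq0 f g : unif_dist f g = 0 -> f = g.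
Proof.
move=> fg0; have : bcont_fun f = bcont_fun g.
  apply/funext => t; apply: mdist_positivity.
  by apply/eqP; rewrite eq_le mdist_ge0 andbT -fg0 unif_dist_ge.
case: f g {fg0} => [f cf bf] [g cg bg] /= fg; rewrite -fg in cg bg *.
by congr BoundedContinuous; exact: Prop_irrelevance.
Qed.

Lemma unif_dist_sym f g : unif_dist f g = unif_dist g f.
Proof.
rewrite /unif_dist; have -> // : (fun t => mdist (f t) (g t))
  = (fun t => mdist (g t) (f t)) by apply/funext => t; exact: metric_sym.
Qed.

Lemma unif_dist_triangle g f h :
  unif_dist f h <= unif_dist f g + unif_dist g h.
Proof.
apply: unif_dist_le => [|t]; first by rewrite addr_ge0 ?unif_dist_ge0.
by rewrite (le_trans (metric_triangle _ (g t) _))// lerD ?unif_dist_ge.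
Qed.

HB.instance Definition _ := @isMetric.Build R C
  unif_dist unif_distxx unif_dist_eq0 unif_dist_sym unif_dist_triangle.

End UniformMetric.

Section Operator.
Context {R : realType} {c : R} (hc : 0 < c < 1).
Context {X : metricType R} {I : choiceType} {m : nat} (F : gifs X I m).
Local Notation Omega := (code_space hc m I).
Local Notation C := (bounded_continuous Omega X).

Definition gifs_op_fun (g : {ffun 'I_m -> C}) (a : Omega) : X :=
  F (a 0%N) [ffun j => g j (code_proj a j)].

Let args (g : {ffun 'I_m -> C}) (a : Omega) : {ffun 'I_m -> X} :=
  [ffun j => g j (code_proj a j)].

Lemma gifs_op_continuous g : continuous (gifs_op_fun g).
Proof.
move=> a.
have args_cvg : args g b @[b --> a] --> args g a.
  apply/(@cvgrPdist_le _ {ffun 'I_m -> X} _ _ (nbhs_filter a)) => e e0.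
  have : \forall b \near a, forall j : 'I_m,
      mdist (g j (code_proj a j)) (g j (code_proj b j)) <= e.
    apply: (@filter_forall _ _ _ (nbhs a) (nbhs_filter a)) => j.
    have /(@cvgrPdist_le _ X _ _ (nbhs_filter a)) :
        g j (code_proj b j) @[b --> a] --> g j (code_proj a j).
      exact: cvg_comp (@code_proj_continuous _ _ hc _ _ j a)
        (bcont_continuous (g j) (code_proj a j)).
    exact.
  apply: filterS => b gab; apply: max_dist_le => [|j]; first exact: ltW.
  by rewrite !ffunE.
have head : {near nbhs a, (fun b => F (a 0%N) (args g b)) =1 gifs_op_fun g}.
  apply: (@filterS _ (nbhs a) (nbhs_filter a)) (near_code_head a) => b.
  by rewrite /gifs_op_fun => ->.
apply: cvg_trans (@near_eq_cvg _ _ _ (nbhs_filter a) _ _ head) _.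
exact: cvg_comp args_cvg (gifs_continuous F (a 0%N) (args g a)).
Qed.

Arguments gifs_op_continuous : clear implicits.

Lemma gifs_op_bounded g : metric_bounded (range (gifs_op_fun g)).
Proof.
have [M gM] : exists M : 'I_m -> R, forall j a b,
    mdist (g j a) (g j b) <= M j.
  have /choice[M gM] : forall j : 'I_m, exists M : R, forall a b,
      mdist (g j a) (g j b) <= M.
    by move=> j; have [M gM] := bcont_bounded (g j); exists M => a b; apply: gM.
  by exists M.
have [|N FN] := @gifs_bounded _ _ _ _ F (range (args g)).
  exists (\big[Num.max/0]_j M j) => _ _ [a _ <-] [b _ <-].
  apply: max_dist_le => [|j]; first exact: bigmax_ge_id.
  by rewrite !ffunE (le_trans (gM _ _ _))// le_bigmax.
exists N => _ _ [a _ <-] [b _ <-].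
apply: FN; [exists (a 0%N) => //|exists (b 0%N) => //].
  by exists (args g a) => //; exists a.
by exists (args g b) => //; exists b.
Qed.

Definition gifs_op (g : {ffun 'I_m -> C}) : C :=
  BoundedContinuous (gifs_op_continuous g) (gifs_op_bounded g).

End Operator.

Arguments gifs_op {R c} hc {X I m} F g.

(* Main.v *)
Require Import Defs.
From mathcomp Require Import all_boot all_order all_algebra.
From mathcomp Require Import all_classical all_reals all_analysis.

Import Order.TTheory GRing.Theory Num.Theory.
Import numFieldNormedType.Exports.

Local Open Scope classical_set_scope.
Local Open Scope ring_scope.

(** Since [I] is finite, the Meir-Keeler gaps of the [f_i] at a given [eps] have
    a positive minimum [delta]. If [g] and [h] are at distance less than
    [eps + delta], then so are the arguments fed to [f_(a^1)] at every code [a],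
    hence [H g] and [H h] are at distance less than [eps] at every single [a].

    The conclusion needs the supremum of these distances to be less than [eps]
    as well, and a supremum of numbers less than [eps] may be equal to [eps];
    shrinking [delta] does not repair this, because a Meir-Keeler map may send
    pairs whose distances decrease to [eps] to pairs whose distances increase to
    [eps]. What saves the claim is that a finite [I] makes every level of the
    code space finite, so that the code space is compact: by Tychonoff it is
    compact for the product of the discrete topologies, and the metric topology
    is no finer than that ([compact_code_space]). The supremum of the continuous
    function [a |-> d (H g a) (H h a)] is then attained, which makes it less
    than [eps] ([unif_dist_lt]). *)

Lemma mdist_continuous {R : realType} {T : topologicalType} {U : metricType R}
    (f g : T -> U) :
  continuous f -> continuous g -> continuous (fun t => mdist (f t) (g t)).
Proof.
move=> cf cg a; apply/(@cvgrPdist_le _ R^o _ _ (nbhs_filter a)) => e e0.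
have e2 : 0 < e / 2 by rewrite divr_gt0.
have dist_le h :=
  @metricType_numDomainType.cvgr_dist_le _ U _ _ (nbhs_filter a) h.
apply: filterS2 (dist_le _ _ (cf a) _ e2) (dist_le _ _ (cg a) _ e2) => t fat gat.
(* The distance is 1-Lipschitz for the sum of the coordinate distances. *)
have tri : forall x y x' y' : U,
    mdist x y - mdist x' y' <= mdist x x' + mdist y y'.
  move=> x y x' y'; rewrite lerBlDr -addrA [mdist y y' + _]addrC.
  rewrite (le_trans (metric_triangle _ x' _)) ?lerD2l//.
  rewrite (le_trans (metric_triangle _ y' _)) ?lerD2l//.
  by rewrite [mdist y' y]metric_sym.
have fg : mdist (f a) (f t) + mdist (g a) (g t) <= e.
  by rewrite [e]splitr lerD.
rewrite ler_norml lerNl opprB !(le_trans _ fg) ?tri//.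
by rewrite (le_trans (tri _ _ _ _))// metric_sym [mdist (g t) _]metric_sym.
Qed.

(** Compactness is what makes a strict pointwise bound a strict uniform one: the
    supremum is the distance at some point, unless [T] is empty. *)
Lemma unif_dist_lt {R : realType} {T U : metricType R}
    (f g : bounded_continuous T U) (e : R) :
  compact [set: T] -> 0 < e -> (forall t, mdist (f t) (g t) < e) ->
  mdist f g < e.
Proof.
move=> T_compact e0 fge.
have dist_continuous :=
  mdist_continuous _ _ (bcont_continuous f) (bcont_continuous g).
have [T0|/set0P T_neq0] := eqVneq [set: T] set0.
  apply: le_lt_trans e0; apply: unif_dist_le => // t.
  by have : [set: T] t by []; rewrite T0.
have [t0 _ t0_max] : exists2 t0 : T, t0 \in [set: T] &
    forall t, t \in [set: T] -> mdist (f t) (g t) <= mdist (f t0) (g t0).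
  by apply: compact_EVT_max => //; exact: continuous_subspaceT.
apply: le_lt_trans (fge t0); apply: unif_dist_le => [|t]; first exact: mdist_ge0.
by apply: t0_max; rewrite inE.
Qed.

(** [T] is only a [choiceType], so finiteness is obtained from the [finType] of
    functions into the subtype [seq_sub s] of an enumeration [s] of [T]. *)
Lemma finite_set_ffun (J : finType) (T : choiceType) :
  finite_set [set: T] -> finite_set [set: {ffun J -> T}].
Proof.
move=> /finite_seqP[s sT].
have s_full x : x \in s by have : [set: T] x by []; rewrite sT.
pose vals (h : {ffun J -> seq_sub s}) : {ffun J -> T} := [ffun j => ssval (h j)].
suff -> : [set: {ffun J -> T}] = vals @` [set: {ffun J -> seq_sub s}].
  exact/finite_image/finite_finset.
apply/seteqP; split=> // g _; exists [ffun j => SeqSub (s_full (g j))] => //.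
by apply/ffunP => j; rewrite !ffunE.
Qed.

Lemma finite_code_level (m : nat) (I : choiceType) (k : nat) :
  finite_set [set: I] -> finite_set [set: code_level m I k].
Proof. by move=> Ifin; elim: k => //= k; exact: finite_set_ffun. Qed.

Section CodeCompact.
Context {R : realType} {c : R} (hc : 0 < c < 1) (m : nat) (I : choiceType).
Local Notation Omega := (code_space hc m I).

Let c_gt0 : 0 < c. Proof. by case/andP: hc. Qed.
Let c_lt1 : c < 1. Proof. by case/andP: hc. Qed.

(** Only the levels from [n] on contribute, so the distance is at most the
    geometric tail [\sum_(k >= n) c ^+ k.+1 = c ^+ n.+1 / (1 - c)]; this is why
    cylinders are neighborhoods for the metric. *)
Lemma code_dist_le_prefix (a b : Omega) (n : nat) :
  (forall k, (k < n)%N -> a k = b k) -> (1 - c) * mdist a b <= c ^+ n.+1.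
Proof.
move=> ab; rewrite mulrC -ler_pdivlMr ?subr_gt0//.
apply: limr_le; first exact: is_cvg_code_term.
apply: nearW => N; rewrite ler_pdivlMr ?subr_gt0// mulrC.
rewrite seriesEnat/= mulr_sumr.
(* Each term, multiplied by 1 - c, is at most an increment of u: both are 0
   below n, and (1 - c) * c ^+ k.+1 = c ^+ k.+1 - c ^+ k.+2 from n on. *)
pose u k := - c ^+ (maxn n k).+1.
apply: (@le_trans _ _ (\sum_(0 <= k < N) (u k.+1 - u k))).
  apply: ler_sum => k _; rewrite /u opprK [leRHS]addrC.
  have [kn|nk] := ltnP k n.
    by rewrite /code_term ab// eqxx !mulr0 (maxn_idPl kn) subrr.
  rewrite (maxn_idPr (leqW nk)) [c ^+ k.+2]exprS.
  rewrite -{1}[c ^+ k.+1]mul1r -mulrBl ler_wpM2l ?subr_ge0 ?(ltW c_lt1)//.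
  by rewrite ler_piMr ?exprn_ge0 ?(ltW c_gt0)//; case: eqP.
by rewrite telescope_sumr// /u maxn0 opprK gerDr oppr_le0 exprn_ge0 ?ltW.
Qed.

(** The identity from the product of the discrete levels onto the metric code
    space is continuous, so it carries Tychonoff compactness over. *)
Lemma compact_code_space : finite_set [set: I] -> compact [set: Omega].
Proof.
move=> Ifin.
pose level k := discrete_topology (code_level m I k).
pose P := prod_topology level.
have P_compact : compact [set: P].
  have := @tychonoff nat level (fun k => [set: level k])
    (fun k => @finite_compact (level k) setT (finite_code_level m I k Ifin)).
  by congr compact; apply/seteqP; split.
pose topology_change : P -> Omega := id.
suff cont : continuous topology_change.
  have -> : [set: Omega] = topology_change @` [set: P].
    by apply/seteqP; split=> // a _; exists a.
  by apply: continuous_compact P_compact; exact: continuous_subspaceT.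
move=> a.
apply/(@metricType_numDomainType.cvgrPdist_lt _ Omega _ _ (nbhs_filter a)).
move=> e e0.
(* Codes agreeing on the first n levels are at distance less than e. *)
have [n cn] : exists n : nat, c ^+ n.+1 < (1 - c) * e.
  have ce : 0 < (1 - c) * e by rewrite mulr_gt0// subr_gt0.
  have := @cvg_expr R c; rewrite gtr0_norm// => /(_ c_lt1) cvg0.
  have /cvgrPdist_lt/(_ _ ce) [N _ /(_ N.+1 (leqnSn N))/=] := cvg0.
  by rewrite sub0r normrN gtr0_norm ?exprn_gt0// => ?; exists N.
have prefix : \forall b \near a, forall k : 'I_n, (b : P) k = a k.
  apply: (@filter_forall _ _ _ (nbhs a) (nbhs_filter a)) => k.
  exact: (@proj_continuous _ level k a [set a k]
    (discrete_set1 (a k : level k))).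
apply: (@filterS _ (nbhs a) (nbhs_filter a)) prefix => b ab.
rewrite -(@ltr_pM2l _ (1 - c)) ?subr_gt0//; apply: le_lt_trans cn.
by apply: code_dist_le_prefix => k kn; exact: esym (ab (Ordinal kn)).
Qed.

End CodeCompact.

Lemma meir_keeler_common_gap {R : realType} {X : metricType R}
    {I : choiceType} {m : nat}
    (f : I -> {ffun 'I_m -> X} -> X) :
  finite_set [set: I] -> (forall i, meir_keeler (f i)) ->
  forall eps : R, 0 < eps -> exists2 delta : R, 0 < delta &
    forall i x y, mdist x y < eps + delta -> mdist (f i x) (f i y) < eps.
Proof.
move=> /finite_seqP[s sI] fMK eps eps0.
have /choice[d dP] : forall i, exists d : R, 0 < d /\
    forall x y, mdist x y < eps + d -> mdist (f i x) (f i y) < eps.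
  by move=> i; have [d d0 dP] := fMK i _ eps0; exists d.
exists (\big[Num.min/1]_(i <- s) d i).
  by apply: lt_bigmin => // i _; case: (dP i).
move=> i x y xy; apply: (dP i).2; apply: lt_le_trans xy _; rewrite lerD2l.
have si : i \in s by have : [set: I] i by []; rewrite sI.
exact: bigmin_inf_seq si _ (lexx _).
Qed.

Theorem proposition3p5 (R : realType) (X : metricType R) (I : choiceType)
    (m : nat) (c : R) (hc : 0 < c < 1) (F : gifs X I m)
    (m_gt0 : (0 < m)%N) (X_neq0 : [set: X] !=set0) (I_neq0 : [set: I] !=set0)
    (I_finite : finite_set [set: I])
    (F_meir_keeler : forall i : I, meir_keeler (F i)) :
  meir_keeler (gifs_op hc F).
Proof.
move=> eps eps0.
have [delta delta0 Fdelta] :=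
  meir_keeler_common_gap _ I_finite F_meir_keeler _ eps0.
exists delta => // g h gh; apply: unif_dist_lt => //.
  exact: compact_code_space.
move=> a; apply: Fdelta; apply: le_lt_trans gh.
apply: max_dist_le => [|j]; first exact: mdist_ge0.
rewrite !ffunE; apply: le_trans (unif_dist_ge _ _ _) _.
exact: (max_dist_ge g h j).
Qed.
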